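(* Let $k>1$ and $H=K_k$. For all $p\ge n^{-2/(k-1)}$, $$\Pr\left(\xi_H\ge 2\,\mathbf{E}(\xi_H)\right)\ge \exp\left[-O_H(f(k,n,p))\right],$$ where $\xi_H=\xi_H^{n,p}$ is the number of copies of $H$ in $G(n,p)$ and $f(k,n,p)=\min\{n^2p^{k-1}\log(1/p),\; n^kp^{\binom{k}{2}}\}$.
   Context: $G(n,p)$ is the Erdős–Rényi random graph on $n$ vertices in which every edge occurs independently with probability $p$. A copy of $H$ in $G(n,p)$ is any subgraph of $G(n,p)$ isomorphic to $H$. The notation $O_H(\cdot)$ means that the implied constant depends only on $H$ (that is, only on $k$).
   Formalization: Added hypothesis: some graph on n vertices has at least 2E(ξ_H) copies of H (i.e. n<k or 2p^{binom(k,2)} ≤ 1); otherwise the probability is 0 and the claimed bound fails, e.g. at p=1 with n ≥ k. Also n ≥ 1 and p ≤ 1 are made explicit. *)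

(* Defs.v *)
From HB Require Import structures.
From mathcomp Require Import all_boot all_order all_algebra.
From mathcomp Require Import reals sequences exp.

Set Implicit Arguments.
Unset Strict Implicit.
Unset Printing Implicit Defensive.

Import Order.TTheory GRing.Theory Num.Theory.

Local Open Scope ring_scope.

Definition pairs (V : finType) : {set {set V}} :=
  [set e : {set V} | #|e| == 2%N].

Record sgraph (V : finType) := SGraph {
  edges : {set {set V}};
  edges_pairs : edges \subset pairs V
}.

HB.instance Definition _ (V : finType) := [isSub for @edges V].
HB.instance Definition _ (V : finType) := [Finite of sgraph V by <:].

Definition complete_graph (k : nat) : sgraph 'I_k :=
  SGraph (subxx (pairs 'I_k)).

(* A candidate subgraph is a pair (vertex set, edge set). *)
Definition is_subgraph (V : finType) (G : sgraph V)
    (S : {set V} * {set {set V}}) : bool :=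
  (S.2 \subset edges G) && [forall e in S.2, e \subset S.1].

Definition is_isomorphic (U V : finType) (H : sgraph U)
    (S : {set V} * {set {set V}}) : bool :=
  [exists f : {ffun U -> V},
    [&& injectiveb f,
        [set f u | u : U] == S.1 &
        [set [set f u | u in e] | e : {set U} in edges H] == S.2]].

(* Copies are unlabelled: they are counted as subgraphs, not as embeddings. *)
Definition ncopies (U V : finType) (H : sgraph U) (G : sgraph V) : nat :=
  #|[set S : {set V} * {set {set V}} | is_subgraph G S && is_isomorphic H S]|.

Section RandomGraph.
Variables (R : realType) (n : nat) (p : R).

Definition gnp_mass (G : sgraph 'I_n) : R :=
  \prod_(e in pairs 'I_n) (if e \in edges G then p else 1 - p).

Definition gnp_Pr (A : pred (sgraph 'I_n)) : R :=
  \sum_(G : sgraph 'I_n | A G) gnp_mass G.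

Definition gnp_E (X : sgraph 'I_n -> R) : R :=
  \sum_(G : sgraph 'I_n) X G * gnp_mass G.

End RandomGraph.

Definition xi (R : realType) (k n : nat) (G : sgraph 'I_n) : R :=
  (ncopies (complete_graph k) G)%:R.

Definition rate (R : realType) (k n : nat) (p : R) : R :=
  Num.min (n%:R ^+ 2 * p ^+ (k - 1) * ln (1 / p))
          (n%:R ^+ k * p ^+ 'C(k, 2)).

(* Main.v *)
(** Write m = n p^((k-1)/2) >= 1 and mu = n^k p^C(k,2) = m^k, so that the mean
is at most mu and the rate is min (m^2 log (1/p), mu).

Planting a clique on O(m) vertices doubles the mean and has probability
exp (- O(m^2 log (1/p))), for every p.

If m p <= 1 (or k = 2), the variance of the number of cliques in any family of
k-sets of mean of order 1 is bounded, as the pairs of k-sets meeting in at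
least two vertices contribute O(1) to the second moment; such a family thus
contains a clique with probability bounded below.  Splitting the k-sets into
M = O(mu) disjoint families of this kind, with M at least twice the mean,
Harris' inequality shows that all of them contain a clique with probability
at least exp (- O(mu)).

If m p > 1 and k >= 3, then log (1/p) <= 1/p < m, hence
m^2 log (1/p) <= m^3 <= mu and planting already suffices. *)

Require Import Defs.
From mathcomp Require Import all_boot all_order all_algebra.
From mathcomp Require Import reals sequences exp.
From mathcomp Require Import ring lra.

Set Implicit Arguments.
Unset Strict Implicit.
Unset Printing Implicit Defensive.

Import Order.TTheory GRing.Theory Num.Theory.

Local Open Scope ring_scope.

(** * Expectations over independent Bernoulli elements, and Harris' inequality *)

(** Recursion on [s] conditions on one element at a time, so that most facts below, Harris'
    inequality included, are inductions on [s]. [bernoulliE_sum] recovers the usual weighted sum. *)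
Fixpoint bernoulliE (R : realType) (T : finType) (p : R) (s : seq T)
    (f : {set T} -> R) : R :=
  if s is x :: s' then
    p * bernoulliE p s' (fun E => f (x |: E))
    + (1 - p) * bernoulliE p s' f
  else f set0.

Section Bernoulli.
Variables (R : realType) (T : finType) (p : R).
Hypotheses (p_ge0 : 0 <= p) (p_le1 : p <= 1).
Implicit Types (s : seq T) (f g : {set T} -> R) (A E : {set T}).

Let q_ge0 : 0 <= 1 - p. Proof. by rewrite subr_ge0. Qed.

Lemma sum_subset_cons (F : {set T} -> R) x s : x \notin s ->
  \sum_(E : {set T} | E \subset x :: s) F E =
  \sum_(E : {set T} | E \subset s) F (x |: E)
  + \sum_(E : {set T} | E \subset s) F E.
Proof.
move=> xs; rewrite (bigID (fun E : {set T} => x \in E)) /=; congr (_ + _).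
  rewrite (reindex_onto (fun E => x |: E) (fun E => E :\ x)) /=; last first.
    by move=> E /andP[_ xE]; rewrite setD1K.
  apply: eq_bigl => E; rewrite setU11 andbT; apply/andP/idP.
    move=> [/subsetP Es /eqP EK]; apply/subsetP => y yE.
    have := Es y; rewrite !inE yE orbT => /(_ isT) /orP[/eqP yx|//].
    by move: yE; rewrite -EK yx !inE eqxx.
  move=> Es; have xE : x \notin E by apply: contra xs; apply: (subsetP Es).
  split; last by rewrite setU1K.
  apply/subsetP => y; rewrite !inE => /orP[->//|yE].
  by rewrite (subsetP Es) ?orbT.
apply: eq_bigl => E; apply/andP/idP.
  move=> [/subsetP Es xE]; apply/subsetP => y yE.
  have := Es y yE; rewrite inE => /orP[/eqP yx|//].
  by rewrite -yx yE in xE.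
move=> Es; split; last by apply: contra xs; apply: (subsetP Es).
by apply/subsetP => y yE; rewrite inE (subsetP Es) ?orbT.
Qed.

Lemma bernoulliE_sum s f : uniq s ->
  bernoulliE p s f =
  \sum_(E : {set T} | E \subset s)
     f E * \prod_(x <- s) (if x \in E then p else 1 - p).
Proof.
elim: s f => [|x s IH] f /=.
  move=> _; rewrite (big_pred1 set0) ?big_nil ?mulr1 // => E.
  apply/subsetP/eqP => [h|->]; last by move=> y; rewrite inE.
  by apply/setP => y; rewrite inE; apply/negP => /h.
move=> /andP[xs us]; rewrite sum_subset_cons // !IH // !mulr_sumr.
congr (_ + _); apply: eq_bigr => E Es; rewrite big_cons.
  rewrite setU11 mulrCA; congr (_ * (_ * _)); apply: eq_big_seq => y ys.
  rewrite !inE; case: eqP => // yx; by rewrite -yx ys in xs.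
rewrite mulrCA; congr (_ * (_ * _)); rewrite ifN //.
by apply: contra xs; apply: (subsetP Es).
Qed.

Lemma eq_bernoulliE s f g : f =1 g -> bernoulliE p s f = bernoulliE p s g.
Proof.
elim: s f g => [|x s IH] f g fg /=; first exact: fg.
by congr (_ * _ + _ * _); apply: IH => // E; apply: fg.
Qed.

Lemma bernoulliED s f g :
  bernoulliE p s (fun E => f E + g E) = bernoulliE p s f + bernoulliE p s g.
Proof. by elim: s f g => [|x s IH] f g //=; rewrite !IH; ring. Qed.

Lemma bernoulliEZ s a f :
  bernoulliE p s (fun E => a * f E) = a * bernoulliE p s f.
Proof. by elim: s f => [|x s IH] f //=; rewrite !IH; ring. Qed.

Lemma bernoulliE0 s : bernoulliE p s (fun=> 0) = 0.
Proof. by elim: s => [|x s IH] //=; rewrite !IH; ring. Qed.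

Lemma bernoulliE1 s : bernoulliE p s (fun=> 1) = 1.
Proof. by elim: s => [|x s IH] //=; rewrite !IH; ring. Qed.

Lemma bernoulliE_big (I : Type) (r : seq I) (P : pred I)
    (F : I -> {set T} -> R) s :
  bernoulliE p s (fun E => \sum_(i <- r | P i) F i E) =
  \sum_(i <- r | P i) bernoulliE p s (F i).
Proof.
elim: r => [|i r IH].
  rewrite big_nil; apply: etrans (bernoulliE0 s).
  by apply: eq_bernoulliE => E; rewrite big_nil.
rewrite big_cons -IH; case: ifP => Pi; last first.
  by apply: eq_bernoulliE => E; rewrite big_cons Pi.
by rewrite -bernoulliED; apply: eq_bernoulliE => E; rewrite big_cons Pi.
Qed.

Lemma ler_bernoulliE s f g :
  (forall E, f E <= g E) -> bernoulliE p s f <= bernoulliE p s g.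
Proof.
elim: s f g => [|x s IH] f g fg //=.
by apply: lerD; apply: ler_wpM2l => //; apply: IH => E.
Qed.

Definition increasing_set f := forall A B : {set T}, A \subset B -> f A <= f B.

(** Conditioning on [x], the two conditional covariances are nonnegative by induction. What remains
    is [p * (1 - p)] times the product of the increments of the two conditional means, both
    nonnegative by monotonicity. *)
Lemma harris s f g : increasing_set f -> increasing_set g ->
  bernoulliE p s f * bernoulliE p s g <= bernoulliE p s (fun E => f E * g E).
Proof.
elim: s f g => [|x s IH] f g fI gI //=.
have upI h : increasing_set h -> increasing_set (fun E => h (x |: E)).
  by move=> hI A B AB; apply: hI; apply: setUS.
have h01 h : increasing_set h ->
    bernoulliE p s h <= bernoulliE p s (fun E => h (x |: E)).
  by move=> hI; apply: ler_bernoulliE => E; apply: hI; apply: subsetUr.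
have := IH _ _ fI gI; have := IH _ _ (upI _ fI) (upI _ gI).
move: (h01 _ fI) (h01 _ gI).
set a0 := bernoulliE p s f; set b0 := bernoulliE p s g.
set a1 := bernoulliE p s _; set b1 := bernoulliE p s _.
set c1 := bernoulliE p s _; set c0 := bernoulliE p s _.
move=> a01 b01 H1 H0.
have e : 0 <= (p * (1 - p)) * ((a1 - a0) * (b1 - b0)).
  by rewrite !mulr_ge0 ?subr_ge0.
have e1 : 0 <= p * (c1 - a1 * b1) by rewrite mulr_ge0 ?subr_ge0.
have e0 : 0 <= (1 - p) * (c0 - a0 * b0) by rewrite mulr_ge0 ?subr_ge0.
rewrite -subr_ge0.
have -> : p * c1 + (1 - p) * c0 - (p * a1 + (1 - p) * a0) * (p * b1 + (1 - p) * b0)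
  = p * (c1 - a1 * b1) + (1 - p) * (c0 - a0 * b0)
    + (p * (1 - p)) * ((a1 - a0) * (b1 - b0)) by ring.
by rewrite !addr_ge0.
Qed.

Lemma bernoulliE_notin s A : ~~ (A \subset s) ->
  bernoulliE p s (fun E => (A \subset E)%:R) = 0.
Proof.
elim: s A => [|x s IH] A /=.
  move=> nA; rewrite (_ : A \subset set0 = false) //; apply: contraNF nA.
  by rewrite subset0 => /eqP ->; apply/subsetP => y; rewrite inE.
move=> nAs; rewrite [X in _ + _ * X]IH ?mulr0 ?addr0; last first.
  apply: contra nAs => /subsetP As; apply/subsetP => y /As ys.
  by rewrite inE ys orbT.
rewrite (@eq_bernoulliE _ _ (fun E => (A :\ x \subset E)%:R)); last first.
  by move=> E; rewrite subDset.
rewrite IH ?mulr0 //; apply: contra nAs => /subsetP As; apply/subsetP => y yA.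
by rewrite inE; case: eqP => //= /eqP yx; apply: As; rewrite !inE yx.
Qed.

Lemma bernoulliE_subset s A : uniq s -> A \subset s ->
  bernoulliE p s (fun E => (A \subset E)%:R) = p ^+ #|A|.
Proof.
elim: s A => [|x s IH] A /=.
  move=> _ As; have -> : A = set0.
    by apply/setP => y; rewrite inE; apply/negP => /(subsetP As).
  by rewrite sub0set cards0 expr0.
move=> /andP[xs us] /subsetP As.
rewrite (@eq_bernoulliE _ (fun E => (A \subset x |: E)%:R)
  (fun E => (A :\ x \subset E)%:R)); last by move=> E; rewrite subDset.
have Axs : A :\ x \subset s.
  by apply/subsetP => y; rewrite !inE => /andP[yx /As]; rewrite inE (negPf yx).
rewrite IH //; case: (boolP (x \in A)) => xA.
  rewrite bernoulliE_notin ?mulr0 ?addr0; last first.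
    by apply: contra xs => /subsetP; apply.
  by rewrite (cardsD1 x A) xA exprS.
have AD : A :\ x = A.
  by apply/setP => y; rewrite !inE; case: eqP => // ->; rewrite (negPf xA).
by rewrite AD in Axs *; rewrite IH //; ring.
Qed.

End Bernoulli.

(** * Cliques, and copies of a complete graph *)

Definition clique_edges (V : finType) (A : {set V}) : {set {set V}} :=
  [set e in pairs V | e \subset A].

Definition ksets (V : finType) (k : nat) : {set {set V}} :=
  [set A : {set V} | #|A| == k].

(** The family [F] is a parameter because the k-sets are later split into disjoint families. *)
Definition ncliques (V : finType) (F E : {set {set V}}) : nat :=
  #|[set A in F | clique_edges A \subset E]|.

Section Cliques.
Variable V : finType.
Implicit Types (A B : {set V}) (E F : {set {set V}}) (k : nat).

Lemma card_clique_edges A : #|clique_edges A| = 'C(#|A|, 2).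
Proof.
rewrite -cards_draws; apply: eq_card => e.
by rewrite !inE andbC.
Qed.

Lemma card_ksets k : #|ksets V k| = 'C(#|V|, k).
Proof. by rewrite -card_draws; apply: eq_card => e; rewrite !inE. Qed.

Lemma clique_edges_pairs A : clique_edges A \subset pairs V.
Proof. by apply/subsetP => e; rewrite inE => /andP[]. Qed.

Lemma clique_edgesI A B :
  clique_edges A :&: clique_edges B = clique_edges (A :&: B).
Proof. by apply/setP => e; rewrite !inE subsetI; case: (#|e| == _). Qed.

Lemma clique_edgesS A B : A \subset B -> clique_edges A \subset clique_edges B.
Proof.
move=> AB; apply/subsetP => e; rewrite !inE => /andP[-> /= eA].
exact: subset_trans AB.
Qed.

(** An injection carries the set of all pairs onto the set of all pairs of its image, so only the
    size of the vertex set matters. *)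
Lemma is_isomorphic_complete k (S : {set V} * {set {set V}}) :
  is_isomorphic (complete_graph k) S = (#|S.1| == k) && (S.2 == clique_edges S.1).
Proof.
have im (f : 'I_k -> V) : injective f ->
    [set [set f u | u in e] | e : {set 'I_k} in pairs 'I_k]
    = clique_edges [set f u | u : 'I_k].
  move=> fI; apply/setP => e; rewrite !inE; apply/imsetP/andP.
    move=> [d]; rewrite inE => d2 ->; rewrite card_imset //; split => //.
    by apply: imsetS; apply/subsetP.
  move=> [e2 es]; have eE : [set f u | u in f @^-1: e] = e.
    apply/setP => v; apply/imsetP/idP => [[u]|ve]; first by rewrite inE => ? ->.
    have /imsetP[u _ vu] := subsetP es v ve.
    by exists u => //; rewrite inE -vu.
  by exists (f @^-1: e) => //; rewrite inE -(card_imset _ fI) eE.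
apply/existsP/andP.
  move=> [f /and3P[/injectiveP fI /eqP <- /eqP <-]]; split.
    by rewrite card_imset // card_ord.
  by rewrite (im f fI).
(* An empty vertex set is treated apart: it offers no vertex to serve as the default of [nth], and
   the embedding is the empty function. *)
move=> [/eqP kS /eqP ->]; case: (set_0Vmem S.1) => [S0|[v0 v0S]].
  have k0 : k = 0%N by rewrite -kS S0 cards0.
  have noI (i : 'I_k) : False by have := ltn_ord i; rewrite {2}k0.
  exists [ffun i => False_rect V (noI i)].
  have fI : injective [ffun i => False_rect V (noI i)] by move=> i; case: (noI i).
  have iE : [set [ffun i => False_rect V (noI i)] u | u : 'I_k] = S.1.
    by rewrite S0; apply/setP => v; rewrite inE; apply/imsetP => -[u]; case: (noI u).
  by apply/and3P; split; [apply/injectiveP|apply/eqP|rewrite im // iE].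
have le i : (i < k -> i < size (enum S.1))%N by rewrite -cardE kS.
pose f : {ffun 'I_k -> V} := [ffun i : 'I_k => nth v0 (enum S.1) i].
have fI : injective f.
  move=> i j; rewrite !ffunE => /eqP.
  by rewrite nth_uniq ?enum_uniq ?le // => /eqP/val_inj.
have iE : [set f u | u : 'I_k] = S.1.
  apply/eqP; rewrite eqEcard card_imset // card_ord kS leqnn andbT.
  apply/subsetP => v /imsetP[i _ ->]; rewrite ffunE -mem_enum mem_nth //.
  exact: le.
by exists f; apply/and3P; split; [apply/injectiveP|apply/eqP|rewrite im // iE].
Qed.

(** A copy of a complete graph is determined by its vertex set. *)
Lemma ncopies_complete k (G : sgraph V) :
  ncopies (complete_graph k) G = ncliques (ksets V k) (edges G).
Proof.
rewrite /ncopies /ncliques -(@card_imset _ _ (fun A => (A, clique_edges A))); last first.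
  by move=> A B [].
apply: eq_card => -[A F]; rewrite inE is_isomorphic_complete /=.
apply/andP/imsetP.
  move=> [/andP[/= FG _] /andP[Ak /eqP FE]].
  by exists A; rewrite ?FE // !inE Ak /= -FE.
move=> [B]; rewrite !inE => /andP[Bk BG] [-> ->]; split; last by rewrite Bk /=.
rewrite /is_subgraph /= BG; apply/forallP => e; apply/implyP.
by rewrite inE => /andP[].
Qed.

Lemma ncliquesS F E E' : E \subset E' -> (ncliques F E <= ncliques F E')%N.
Proof.
move=> EE; apply: subset_leq_card; apply/subsetP => A; rewrite !inE.
by move=> /andP[-> /= AE]; apply: subset_trans EE.
Qed.

Lemma ncliques_sum (R : realType) F E :
  (ncliques F E)%:R = \sum_(A in F) (clique_edges A \subset E)%:R :> R.
Proof.
rewrite /ncliques -sum1_card natr_sum big_mkcond /= [RHS]big_mkcond /=.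
by apply: eq_bigr => A _; rewrite !inE; case: (A \in F); case: (_ \subset _).
Qed.

End Cliques.

(** * G(n,p) as a Bernoulli measure on pairs, and the mean number of cliques *)

Section Gnp.
Variables (R : realType) (n : nat) (p : R).

Lemma gnp_E_bernoulli (f : {set {set 'I_n}} -> R) :
  gnp_E p (fun G => f (edges G)) = bernoulliE p (enum (pairs 'I_n)) f.
Proof.
rewrite bernoulliE_sum ?enum_uniq // /gnp_E.
have sub (E : {set {set 'I_n}}) : (E \subset enum (pairs 'I_n)) = (E \subset pairs 'I_n).
  by apply: eq_subset_r => e; rewrite mem_enum.
(* The graph [g0] is only the default value of [insubd], for edge sets that are not sets of
   pairs. *)
pose g0 : sgraph 'I_n := complete_graph n.
rewrite (eq_bigl _ _ sub) [RHS](reindex_onto (@edges 'I_n) (insubd g0)); last first.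
  by move=> E Es; rewrite (insubdK g0).
apply: eq_big => [G|G _]; last by rewrite big_enum.
rewrite edges_pairs /=; apply/esym/eqP; exact: (valKd g0).
Qed.

Lemma gnp_Pr_bernoulli (P : pred {set {set 'I_n}}) :
  gnp_Pr p (fun G => P (edges G)) =
  bernoulliE p (enum (pairs 'I_n)) (fun E => (P E)%:R).
Proof.
rewrite -gnp_E_bernoulli /gnp_Pr /gnp_E big_mkcond /=.
by apply: eq_bigr => G _; case: (P _); rewrite ?mul1r ?mul0r.
Qed.

Lemma bernoulliE_clique (A : {set 'I_n}) :
  bernoulliE p (enum (pairs 'I_n)) (fun E => (clique_edges A \subset E)%:R)
  = p ^+ 'C(#|A|, 2).
Proof.
rewrite bernoulliE_subset ?enum_uniq ?card_clique_edges //.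
by apply/subsetP => e /(subsetP (clique_edges_pairs A)); rewrite mem_enum.
Qed.

Lemma gnp_E_xi k : gnp_E p (@xi R k n) = 'C(n, k)%:R * p ^+ 'C(k, 2).
Proof.
have -> : gnp_E p (@xi R k n) =
    gnp_E p (fun G => (ncliques (ksets 'I_n k) (edges G))%:R).
  by apply: eq_bigr => G _; rewrite /xi ncopies_complete.
rewrite (gnp_E_bernoulli (fun E => (ncliques (ksets 'I_n k) E)%:R)).
rewrite (eq_bernoulliE _ _ (ncliques_sum R _)).
rewrite bernoulliE_big (eq_bigr (fun=> p ^+ 'C(k, 2))) => [|A].
  by rewrite sumr_const card_ksets card_ord mulr_natl.
by rewrite inE => /eqP kA; rewrite bernoulliE_clique kA.
Qed.

End Gnp.

(** * Powers against falling factorials and binomials *)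

Lemma ffact_le_exp n m : (n ^_ m <= n ^ m)%N.
Proof.
by elim: m => [|m IH] //; rewrite ffactnSr expnSr leq_mul // leq_subr.
Qed.

Lemma exp_le_ffact n m : (n ^ m <= (n + m) ^_ m)%N.
Proof.
elim: m => [|m IH] //; rewrite addnS ffactnS expnS leq_mul //.
by rewrite -addnS leq_addr.
Qed.

Lemma bin_le_exp n m : ('C(n, m) <= n ^ m)%N.
Proof.
apply: leq_trans (ffact_le_exp n m).
by rewrite -bin_ffact leq_pmulr ?fact_gt0.
Qed.

(** * The second moment method *)

Section SecondMoment.
Variables (R : realType) (T : finType) (p : R).
Hypotheses (p_ge0 : 0 <= p) (p_le1 : p <= 1).

(** For every real l, the indicator of X > 0 is at least 2 l X - l^2 X^2, since (1 - l X)^2 >= 0.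
    The choice l = 1 / (e + D) makes the expectation of this minorant at least e / (e + D), which is
    monotone in e. *)
Lemma second_moment (s : seq T) (X : {set T} -> nat) (a D : R) :
  let e := bernoulliE p s (fun E => (X E)%:R) in
  0 < a -> 0 <= D -> a <= e ->
  bernoulliE p s (fun E => (X E)%:R ^+ 2) <= e ^+ 2 + D * e ->
  a / (a + D) <= bernoulliE p s (fun E => (0 < X E)%N%:R).
Proof.
move=> e a0 D0 ae bD; have eD : 0 < e + D by lra.
pose l := (e + D)^-1.
have key E : 2 * l * (X E)%:R + (- l ^+ 2) * (X E)%:R ^+ 2 <= (0 < X E)%N%:R :> R.
  case: (X E) => [|x]; first by rewrite expr0n /= !mulr0 addr0.
  rewrite -subr_ge0 /= (_ : _ - _ = (1 - l * x.+1%:R) ^+ 2) ?sqr_ge0 //.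
  by rewrite mulr1n; ring.
apply: le_trans (ler_bernoulliE p_ge0 p_le1 s key).
rewrite bernoulliED !bernoulliEZ -/e.
have h : l ^+ 2 * bernoulliE p s (fun E => (X E)%:R ^+ 2) <= l ^+ 2 * (e ^+ 2 + D * e).
  by apply: ler_wpM2l => //; rewrite sqr_ge0.
have h2 : 2 * l * e - l ^+ 2 * (e ^+ 2 + D * e) = e / (e + D).
  by rewrite /l; field; rewrite gt_eqF.
have h3 : a / (a + D) <= e / (e + D).
  rewrite ler_pdivrMr ?ltr_pwDl // mulrAC ler_pdivlMr //.
  by have := ler_wpM2r D0 ae; lra.
rewrite mulNr; lra.
Qed.

End SecondMoment.

(** * Cliques in families of k-sets *)

Section CliqueFamilies.
Variables (R : realType) (n k : nat) (p : R).
Hypotheses (p_ge0 : 0 <= p) (p_le1 : p <= 1).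
(* Given a clique on j vertices, the expected number of k-cliques extending it
   is at most of order 1, so overlaps do not dominate the second moment. *)
Hypothesis extension_le1 : forall j, (1 < j <= k)%N ->
  n%:R ^+ (k - j) * p ^+ ('C(k, 2) - 'C(j, 2)) <= 1.

Let s := enum (pairs 'I_n).
Let q := p ^+ 'C(k, 2).
Implicit Types (A B J : {set 'I_n}) (F : {set {set 'I_n}}).

Lemma card_clique_edgesU A B :
  #|clique_edges A :|: clique_edges B|
  = ('C(#|A|, 2) + 'C(#|B|, 2) - 'C(#|A :&: B|, 2))%N.
Proof. by rewrite cardsU clique_edgesI !card_clique_edges. Qed.

Lemma bernoulliE_two_cliques A B :
  bernoulliE p s (fun E =>
    (clique_edges A \subset E)%:R * (clique_edges B \subset E)%:R)
  = p ^+ ('C(#|A|, 2) + 'C(#|B|, 2) - 'C(#|A :&: B|, 2)).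
Proof.
rewrite -card_clique_edgesU -(@bernoulliE_subset _ _ _ s) ?enum_uniq //.
  by apply: eq_bernoulliE => E; rewrite subUset -natrM mulnb.
apply/subsetP => e; rewrite mem_enum; apply/subsetP.
by rewrite subUset !clique_edges_pairs.
Qed.

(** Such a [B] contains [J], hence is determined by [B :\: J], a set of k - |J| vertices. *)
Lemma card_ksets_trace A J : (#|J| <= k)%N ->
  (#|[set B in ksets 'I_n k | A :&: B == J]| <= n ^ (k - #|J|))%N.
Proof.
move=> Jk; apply: leq_trans (bin_le_exp _ _).
have -> : 'C(n, k - #|J|) = #|ksets 'I_n (k - #|J|)| by rewrite card_ksets card_ord.
have sub B : A :&: B == J -> J \subset B by move=> /eqP <-; apply: subsetIr.
rewrite -(@card_in_imset _ _ (fun B => B :\: J)).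
  apply: subset_leq_card; apply/subsetP => _ /imsetP[B + ->].
  rewrite !inE => /andP[/eqP Bk /sub JB].
  by rewrite cardsD (setIidPr JB) Bk.
move=> B B'; rewrite !inE => /andP[_ /sub JB] /andP[_ /sub JB'] eD.
by rewrite -(setID B J) -(setID B' J) eD (setIidPr JB) (setIidPr JB').
Qed.

(** Group the sets [B] by their trace J on [A]: each J contributes at most 1 by [extension_le1], and
    [A] has 2^k subsets. *)
Lemma sum_overlap A : #|A| = k ->
  \sum_(B in ksets 'I_n k | (1 < #|A :&: B|)%N)
     p ^+ ('C(k, 2) - 'C(#|A :&: B|, 2)) <= 2 ^+ k.
Proof.
move=> Ak.
rewrite (partition_big (fun B => A :&: B)
  (fun J => (J \in powerset A) && (1 < #|J|)%N)) /=; last first.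
  by move=> B /andP[_ ->]; rewrite powersetE subsetIl.
apply: (@le_trans _ _ (\sum_(J in powerset A) 1)); last first.
  by rewrite sumr_const card_powerset Ak natrX.
rewrite [leRHS](bigID (fun J : {set 'I_n} => (1 < #|J|)%N)) /= -[leLHS]addr0.
apply: lerD; last by apply: sumr_ge0.
apply: ler_sum => J /andP[JA J1].
have Jk : (#|J| <= k)%N by rewrite -Ak subset_leq_card // -powersetE.
rewrite (eq_bigr (fun=> p ^+ ('C(k, 2) - 'C(#|J|, 2)))); last first.
  by move=> B /andP[_ /eqP ->].
rewrite sumr_const -mulr_natl.
have /extension_le1 : (1 < #|J| <= k)%N by rewrite J1.
apply: le_trans.
apply: ler_wpM2r; first by rewrite exprn_ge0.
rewrite -natrX ler_nat; apply: leq_trans (card_ksets_trace A Jk).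
apply: subset_leq_card; apply/subsetP => B.
by rewrite unfold_in /= => /andP[/andP[Bk _] AB]; rewrite inE Bk.
Qed.

(** Two k-sets sharing at most one vertex have disjoint edge sets, so they are independent and
    account for the squared mean. The other pairs are bounded by [sum_overlap]. *)
Lemma second_moment_cliques F : F \subset ksets 'I_n k ->
  bernoulliE p s (fun E => (ncliques F E)%:R ^+ 2)
  <= (#|F|%:R * q) ^+ 2 + 2 ^+ k * (#|F|%:R * q).
Proof.
move=> Fk; have cF A : A \in F -> #|A| = k.
  by move=> /(subsetP Fk); rewrite inE => /eqP.
rewrite (@eq_bernoulliE _ _ _ _ _ (fun E => \sum_(A in F) \sum_(B in F)
  ((clique_edges A \subset E)%:R * (clique_edges B \subset E)%:R))); last first.
  move=> E; rewrite ncliques_sum expr2 big_distrl /=.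
  by apply: eq_bigr => A _; rewrite big_distrr.
rewrite bernoulliE_big.
have -> : (#|F|%:R * q) ^+ 2 + 2 ^+ k * (#|F|%:R * q) =
    \sum_(A in F) (#|F|%:R * q ^+ 2 + q * 2 ^+ k).
  by rewrite sumr_const -mulr_natl; ring.
apply: ler_sum => A AF; rewrite bernoulliE_big.
rewrite (bigID (fun B => 1 < #|A :&: B|)%N) /= addrC; apply: lerD.
  rewrite (eq_bigr (fun=> q ^+ 2)); last first.
    move=> B /andP[BF]; rewrite -leqNgt => AB1.
    rewrite bernoulliE_two_cliques (cF _ AF) (cF _ BF) (@bin_small #|A :&: B| 2) //.
    by rewrite subn0 addnn -mul2n mulnC exprM.
  rewrite sumr_const -(mulr_natl (q ^+ 2)); apply: ler_wpM2r; first by rewrite sqr_ge0.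
  rewrite ler_nat; apply: subset_leq_card; apply/subsetP => B.
  by rewrite unfold_in => /andP[].
rewrite (eq_bigr (fun B => q * p ^+ ('C(k, 2) - 'C(#|A :&: B|, 2)))); last first.
  move=> B /andP[BF _]; rewrite bernoulliE_two_cliques (cF _ AF) (cF _ BF) -exprD addnBA //.
  by apply: leq_bin2l; rewrite -(cF _ AF) subset_leq_card // subsetIl.
rewrite -big_distrr /=; apply: ler_wpM2l; first by rewrite exprn_ge0.
apply: le_trans (sum_overlap (cF _ AF)).
rewrite [leLHS]big_mkcond [leRHS]big_mkcond /=; apply: ler_sum => B _.
case: (boolP (B \in F)) => [/(subsetP Fk) -> //|_ /=].
by case: ifP; rewrite ?exprn_ge0.
Qed.

Lemma clique_in_family F (a : R) : F \subset ksets 'I_n k ->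
  0 < a -> a <= #|F|%:R * q ->
  a / (a + 2 ^+ k) <= bernoulliE p s (fun E => (0 < ncliques F E)%N%:R).
Proof.
move=> Fk a0 aF.
have eE : bernoulliE p s (fun E => (ncliques F E)%:R) = #|F|%:R * q.
  rewrite (eq_bernoulliE _ _ (ncliques_sum R _)) bernoulliE_big.
  rewrite (eq_bigr (fun=> q)) => [|A /(subsetP Fk)].
    by rewrite sumr_const mulr_natl.
  by rewrite inE => /eqP kA; rewrite bernoulliE_clique kA.
apply: second_moment => //; rewrite ?eE //; first by rewrite exprn_ge0.
exact: second_moment_cliques.
Qed.

Lemma increasing_ncliques F m :
  increasing_set (fun E => (m <= ncliques F E)%N%:R : R).
Proof.
move=> E E' EE; rewrite ler_nat; case: (boolP (m <= ncliques F E)%N) => // h.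
by rewrite (leq_trans h (ncliquesS F EE)).
Qed.

(* Harris' inequality over M disjoint subfamilies of F of size N. *)
Lemma many_cliques F (N M : nat) (a : R) : F \subset ksets 'I_n k ->
  (M * N <= #|F|)%N -> 0 < a -> a <= N%:R * q ->
  (a / (a + 2 ^+ k)) ^+ M <= bernoulliE p s (fun E => (M <= ncliques F E)%N%:R).
Proof.
move=> + + a0 aN; elim: M F => [|M IH] F Fk; first by rewrite bernoulliE1.
rewrite mulSn => MF.
have /card_geqP[t [tu tN tF]] := leq_trans (leq_addr _ _) MF.
pose F1 := [set A in t].
have F1F : F1 \subset F by apply/subsetP => A; rewrite inE => /tF.
have F1N : #|F1| = N by rewrite cardsE (card_uniqP tu).
have h1 : a / (a + 2 ^+ k) <= bernoulliE p s (fun E => (0 < ncliques F1 E)%N%:R).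
  by apply: clique_in_family => //; [apply: subset_trans Fk|rewrite F1N].
have h2 : (a / (a + 2 ^+ k)) ^+ M <=
    bernoulliE p s (fun E => (M <= ncliques (F :\: F1) E)%N%:R).
  apply: IH; first by apply: subset_trans Fk; apply: subsetDl.
  by rewrite cardsD (setIidPr F1F) F1N leq_subRL // (leq_trans _ MF) // leq_addr.
have d0 : 0 <= a / (a + 2 ^+ k).
  by rewrite divr_ge0 ?addr_ge0 ?exprn_ge0 // ltW.
rewrite exprS; apply: le_trans (ler_pM d0 (exprn_ge0 _ d0) h1 h2) _.
apply: le_trans (harris p_ge0 p_le1 _ (increasing_ncliques _ _)
  (increasing_ncliques _ _)) _.
apply: ler_bernoulliE => // E; rewrite -natrM mulnb ler_nat.
(* The clique found in [F1] is distinct from the [M] found outside [F1], so the counts add up. *)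
case: andP => // -[E1 E2]; suff -> : (M < ncliques F E)%N by [].
apply: leq_trans (leq_add E1 E2) _; rewrite /ncliques.
rewrite -[leqRHS](cardsID F1); apply: leq_add; apply: subset_leq_card.
  by apply/subsetP => A; rewrite !inE => /andP[At ->]; rewrite At tF.
by apply/subsetP => A; rewrite !inE => /andP[/andP[-> ->] ->].
Qed.

End CliqueFamilies.

(** * Lower bounds for the upper tail, by planting and by disjoint families *)

Lemma mul2_bin2 n : (2 * 'C(n, 2) = n.-1 * n)%N.
Proof. by rewrite -(mul_bin_diag n 1) bin1 mulnC. Qed.

Lemma exp_le_bin n k : (k <= n)%N -> (n ^ k <= k ^ k * 'C(n, k))%N.
Proof.
move=> kn; rewrite -(leq_pmul2r (fact_gt0 k)) -mulnA bin_ffact -ffactnn.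
(* The comparison goes factor by factor: n (k - j) <= k (n - j) because k <= n. *)
suff H j : (j <= k)%N -> (n ^ j * k ^_ j <= k ^ j * n ^_ j)%N by exact: H.
elim: j => [//|j IH] jk; rewrite !ffactnSr !expnSr.
rewrite mulnACA [leqRHS]mulnACA leq_mul //; first exact: IH (ltnW jk).
by rewrite !mulnBr mulnC leq_sub2l // leq_mul2r kn orbT.
Qed.

Section UpperTail.
Variables (R : realType) (n k : nat) (p : R).
Hypotheses (p_gt0 : 0 < p) (p_le1 : p <= 1) (k_gt1 : (1 < k)%N).

Let p_ge0 : 0 <= p := ltW p_gt0.
Let s := enum (pairs 'I_n).
Let q := p ^+ 'C(k, 2).
Let mu := n%:R ^+ k * q.
Let m2 := n%:R ^+ 2 * p ^+ (k - 1).
Let L := ln (1 / p).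

Definition upper_tail : R :=
  gnp_Pr p (fun G : sgraph 'I_n => 2 * gnp_E p (@xi R k n) <= xi R k G).

Let q_ge0 : 0 <= q. Proof. by rewrite exprn_ge0. Qed.
Let mu_ge0 : 0 <= mu. Proof. by rewrite mulr_ge0 // exprn_ge0. Qed.
Let m2_ge0 : 0 <= m2. Proof. by rewrite mulr_ge0 // exprn_ge0. Qed.

Lemma ln_inv_ge0 : 0 <= L.
Proof. by rewrite ln_ge0 // div1r invf_ge1. Qed.

Lemma expR_opp_ln_inv : expR (- L) = p.
Proof. by rewrite /L div1r lnV ?posrE // opprK lnK ?posrE. Qed.

Lemma upper_tail_bernoulli : upper_tail =
  bernoulliE p s (fun E =>
    (2 * ('C(n, k)%:R * q) <= (ncliques (ksets 'I_n k) E)%:R)%R%:R).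
Proof.
rewrite -(gnp_Pr_bernoulli p (fun E =>
  2 * ('C(n, k)%:R * q) <= (ncliques (ksets 'I_n k) E)%:R)).
rewrite /upper_tail gnp_E_xi; apply: eq_bigl => G.
by rewrite /xi ncopies_complete.
Qed.

(** No graph has more than C(n,k) cliques of size k. This is the form in which nonemptiness of the
    event enters the bounds below. *)
Lemma upper_tail_nonempty :
  (exists G : sgraph 'I_n, 2 * gnp_E p (@xi R k n) <= xi R k G) ->
  2 * ('C(n, k)%:R * q) <= 'C(n, k)%:R.
Proof.
move=> [G]; rewrite gnp_E_xi => /le_trans; apply.
rewrite /xi ncopies_complete ler_nat -[X in 'C(X, k)]card_ord -card_ksets.
by apply: subset_leq_card; apply/subsetP => A; rewrite inE => /andP[].
Qed.

(** A clique on r fixed vertices costs C(r,2) edges and already contains C(r,k) cliques of size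
    k. *)
Lemma planted_clique r : (r <= n)%N ->
  2 * ('C(n, k)%:R * q) <= 'C(r, k)%:R -> p ^+ 'C(r, 2) <= upper_tail.
Proof.
rewrite -{1}[n]card_ord -cardsT => /card_geqP[t [tu tr _]] rk.
pose A := [set i in t].
have Ar : #|A| = r by rewrite cardsE (card_uniqP tu).
rewrite -{1}Ar -bernoulliE_clique upper_tail_bernoulli.
apply: ler_bernoulliE => // E; rewrite ler_nat.
case: (boolP (_ \subset E)) => // AE; rewrite (le_trans rk) //.
rewrite ler_nat -Ar -cards_draws; apply: subset_leq_card; apply/subsetP => B.
rewrite !inE => /andP[BA ->] /=.
exact: subset_trans (clique_edgesS BA) AE.
Qed.

(** Squaring avoids the possibly half-integral exponent of p in m = n p^((k-1)/2). *)
Lemma sqr_mu : mu ^+ 2 = m2 ^+ k.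
Proof.
rewrite /mu /m2 /q exprMn [RHS]exprMn -!exprM [in LHS]mulnC; congr (_ * _ ^+ _).
by rewrite mulnC mul2_bin2 subn1.
Qed.

Let m := Num.sqrt m2.
Let m_ge0 : 0 <= m := sqrtr_ge0 _.

Lemma sqrt_m2_exp : m ^+ k = mu.
Proof.
apply/eqP; rewrite -(@eqrXn2 _ 2) ?exprn_ge0 //; apply/eqP.
by rewrite sqr_mu -exprM mulnC exprM sqr_sqrtr.
Qed.

Lemma planted_bound : 1 <= m2 ->
  2 * ('C(n, k)%:R * q) <= 'C(n, k)%:R ->
  expR (- ((k + 3)%:R ^+ 2 * (m2 * L))) <= upper_tail.
Proof.
move=> m2_ge1 nonempty.
have m_ge1 : 1 <= m by rewrite -sqrtr1 ler_wsqrtr.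
pose t := Num.truncn (2 * m).
have /andP[tle tlt] : t%:R <= 2 * m < t.+1%:R by apply: truncn_itv; rewrite mulr_ge0.
(* Take r = t + 1 + k, so that the falling factorial of r is at least (t + 1)^k >= (2 m)^k >= 2 mu.
   If this exceeds n, take r = n instead: by [nonempty] the complete graph has enough cliques. *)
have [r [rn rle rk]] : exists r, [/\ (r <= n)%N, (r <= t.+1 + k)%N &
    2 * ('C(n, k)%:R * q) <= 'C(r, k)%:R].
  case: (leqP (t.+1 + k) n) => h; last by exists n; split => //; apply: ltnW.
  exists (t.+1 + k)%N; split => //.
  rewrite -(@ler_pM2r _ k`!%:R) ?ltr0n ?fact_gt0 //.
  rewrite -[leRHS]natrM bin_ffact.
  have -> : 2 * ('C(n, k)%:R * q) * k`!%:R = 2 * ((n ^_ k)%:R * q).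
    by rewrite -bin_ffact natrM; ring.
  apply: (@le_trans _ _ (2 * mu)).
    rewrite ler_pM2l // ler_wpM2r // -natrX ler_nat.
    by apply: ffact_le_exp.
  rewrite -sqrt_m2_exp; apply: (@le_trans _ _ ((2 * m) ^+ k)).
    rewrite exprMn ler_wpM2r ?exprn_ge0 //.
    by rewrite -[leLHS]expr1 ler_eXn2l // ?ltr1n // ltnW.
  apply: (@le_trans _ _ (t.+1%:R ^+ k)).
    by rewrite ler_pXn2r ?nnegrE ?mulr_ge0 ?(ltnW k_gt1) // ltW.
  rewrite -natrX ler_nat; apply: exp_le_ffact.
apply: le_trans (planted_clique rn rk).
(* It remains to bound C(r,2) <= r^2 by (k + 3)^2 m^2. Indeed r <= 2 m + 1 + k <= (k + 3) m, as m >=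
   1. *)
rewrite -expR_opp_ln_inv -expRM_natl ler_expR mulrN lerN2 mulrA.
apply: ler_wpM2r; first exact: ln_inv_ge0.
have -> : m2 = m ^+ 2 by rewrite sqr_sqrtr.
apply: (@le_trans _ _ (r%:R ^+ 2)).
  by rewrite -natrX ler_nat bin_le_exp.
rewrite -exprMn ler_pXn2r ?nnegrE ?mulr_ge0 //.
apply: (@le_trans _ _ (t.+1 + k)%:R); first by rewrite ler_nat.
rewrite !natrD mulrDl.
have : k%:R <= k%:R * m by rewrite ler_peMr.
lra.
Qed.

(** As L p <= 1 and 1 <= m2 p^2, one gets L^2 <= m2. Hence (m2 L)^2 <= m2^3 <= m2^k = mu^2, where k
    >= 3 gives the middle step. *)
Lemma dense_rate_le : (2 < k)%N -> 1 <= m2 -> 1 <= m2 * p ^+ 2 ->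
  m2 * L <= mu.
Proof.
move=> k2 m2_ge1 m2p.
have mln_inv_ge0 : 0 <= m2 * L by apply: mulr_ge0 => //; apply: ln_inv_ge0.
rewrite -(@ler_pXn2r _ 2) ?nnegrE // sqr_mu.
apply: (@le_trans _ _ (m2 ^+ 3)); last by rewrite ler_weXn2l.
have Lp : L * p <= 1.
  rewrite -ler_pdivlMr //; apply: ltW; apply: ln_sublinear.
  by rewrite div1r invr_gt0.
have L2 : L ^+ 2 <= m2.
  have h : (L * p) ^+ 2 <= 1 by rewrite exprn_ile1 ?mulr_ge0 ?ln_inv_ge0.
  by rewrite -(@ler_pM2r _ (p ^+ 2)) ?exprn_gt0 // -exprMn (le_trans h).
by rewrite exprMn [leRHS]exprSr ler_wpM2l ?exprn_ge0.
Qed.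

(** The square of the left side is (m2 p^j)^(k-j), because k (k - 1) - j (j - 1) = (k - j) (k + j -
    1); and p^j <= p^2. When k = 2 the only case is j = k. *)
Lemma extension_bound : m2 * p ^+ 2 <= 1 \/ k = 2%N ->
  forall j, (1 < j <= k)%N ->
  n%:R ^+ (k - j) * p ^+ ('C(k, 2) - 'C(j, 2)) <= 1.
Proof.
move=> hyp j /andP[j1]; rewrite leq_eqVlt => /orP[/eqP ->|jk].
  by rewrite !subnn !expr0 mulr1.
have {}hyp : m2 * p ^+ 2 <= 1.
  by case: hyp => // k2; move: jk; rewrite k2 ltnNge j1.
rewrite -(@expr_le1 _ 2) ?mulr_ge0 ?exprn_ge0 //.
have -> : (n%:R ^+ (k - j) * p ^+ ('C(k, 2) - 'C(j, 2))) ^+ 2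
    = (m2 * p ^+ j) ^+ (k - j).
  rewrite /m2 exprMn -mulrA -exprD [RHS]exprMn -!exprM [in LHS]mulnC.
  congr (_ * _ ^+ _); rewrite mulnC mulnBr !mul2_bin2 subn1.
  case: j j1 jk => // j _ /ltnW/subnKC; move: (k - j.+1)%N => d <-.
  rewrite addSn /=; apply: (canLR (addnK _)); ring.
rewrite exprn_ile1 ?mulr_ge0 ?exprn_ge0 //.
apply: le_trans hyp; apply: ler_wpM2l => //.
by apply: ler_wiXn2l.
Qed.

Lemma many_families_bound (a : R) : 0 < a -> a * (6 * k%:R ^+ k) <= 1 ->
  1 <= m2 ->
  2 * ('C(n, k)%:R * q) <= 'C(n, k)%:R ->
  m2 * p ^+ 2 <= 1 \/ k = 2%N ->
  expR (- (3 * - ln (a / (a + 2 ^+ k)) * mu)) <= upper_tail.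
Proof.
move=> a0 ak m2_ge1 nonempty hyp; set d := a / _.
have kR : 0 < k%:R ^+ k :> R by rewrite exprn_gt0 // ltr0n ltnW.
have D0 : 0 < 2 ^+ k :> R by rewrite exprn_gt0.
have d_gt0 : 0 < d by rewrite divr_gt0 ?addr_gt0.
have lnd : 0 <= - ln d.
  by rewrite oppr_ge0 ln_le0 // ler_pdivrMr ?addr_gt0 // mul1r lerDl ltW.
(* If n < k there are no k-sets: the mean is 0 and the event is certain. *)
case: (ltnP n k) => [nk|kn].
  rewrite upper_tail_bernoulli bin_small //.
  rewrite (@eq_bernoulliE _ _ _ _ _ (fun=> 1)) => [|E]; last first.
    by rewrite mul0r mulr0 ler0n.
  rewrite bernoulliE1 expR_le1 oppr_le0; apply: mulr_ge0 => //.
  exact: mulr_ge0.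
pose K := 'C(n, k); pose x := 2 * (K%:R * q).
have K0 : (0 < K)%N by rewrite bin_gt0.
have q_gt0 : 0 < q by rewrite exprn_gt0.
have x0 : 0 < x by rewrite !mulr_gt0 // ltr0n.
have mu_ge1 : 1 <= mu.
  by rewrite -sqrt_m2_exp exprn_ege1 // -sqrtr1 ler_wsqrtr.
(* [M] is the least natural number that is at least [x], twice the mean. By [nonempty], [K] is a
   candidate, so [M <= K] and the families of size [N] below are nonempty. *)
have KM : exists M : nat, x <= M%:R by exists K.
case: (ex_minnP KM) => M xM Mmin.
have MK : (M <= K)%N by apply: Mmin.
have M0 : (0 < M)%N by rewrite -(ltr0n R) (lt_le_trans x0).
have Mx : M%:R <= x + 1.
  have : ~~ (x <= M.-1%:R) by apply/negP => /Mmin; rewrite -ltnS prednK // ltnn.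
  by rewrite -ltNge -[in M%:R](prednK M0) -natr1 => /ltW; rewrite lerD2r.
pose N := (K %/ M)%N.
(* Rounding K / M down loses at most a factor 2, since the remainder is below M <= M N. *)
have KMN : K%:R <= 2 * (M%:R * N%:R) :> R.
  rewrite -!natrM ler_nat mul2n -addnn {1}(divn_eq K M) mulnC leq_add2l.
  by rewrite (leq_trans (ltnW (ltn_pmod _ M0))) // leq_pmulr // divn_gt0.
have Kmu : K%:R * q <= mu by rewrite ler_wpM2r // -natrX ler_nat bin_le_exp.
have muK : mu <= k%:R ^+ k * (K%:R * q).
  by rewrite mulrA ler_wpM2r // -!natrX -natrM ler_nat exp_le_bin.
(* From M <= 2 K q + 1 <= 3 mu, each family has mean N q >= K q / (2 M) >= K q / (6 mu) >= 1 / (6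
   k^k). *)
have aN : a <= N%:R * q.
  have M3 : M%:R <= 3 * mu by rewrite /x in Mx; lra.
  have h1 : K%:R * q <= 6 * mu * (N%:R * q).
    have h2 : K%:R * q <= 2 * (M%:R * N%:R) * q by rewrite ler_wpM2r.
    apply: le_trans h2 _.
    have : M%:R * (N%:R * q) <= 3 * mu * (N%:R * q) by rewrite ler_wpM2r ?mulr_ge0.
    lra.
  apply: (@le_trans _ _ (6 * k%:R ^+ k)^-1).
    by rewrite -[leRHS]mul1r ler_pdivlMr ?mulr_gt0.
  rewrite -[leLHS]mul1r ler_pdivrMr ?mulr_gt0 //.
  have h3 : k%:R ^+ k * (K%:R * q) <= k%:R ^+ k * (6 * mu * (N%:R * q)).
    by rewrite ler_wpM2l // ltW.
  have h4 := le_trans muK h3.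
  rewrite -(@ler_pM2l _ mu) ?(lt_le_trans ltr01) // mulr1.
  by apply: le_trans h4 _; rewrite le_eqVlt; apply/orP; left; apply/eqP; ring.
have := @many_cliques _ n k p p_ge0 p_le1 (extension_bound hyp)
  (ksets 'I_n k) N M a (subxx _).
rewrite card_ksets card_ord mulnC leq_divM => /(_ isT a0 aN) H.
(* The factor 3 in the exponent is again M <= 3 mu. *)
apply: (@le_trans _ _ (d ^+ M)).
  rewrite -[in leRHS](@lnK _ d) ?posrE // -expRM_natl ler_expR lerNl -mulrN.
  by rewrite mulrAC ler_wpM2r //; rewrite /x in Mx; lra.
apply: le_trans H _; rewrite upper_tail_bernoulli.
apply: ler_bernoulliE => // E; rewrite ler_nat.
case: (boolP (M <= _)%N) => // ME; rewrite (le_trans xM) // ler_nat //.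
Qed.

End UpperTail.

(* When the event xi >= 2 E(xi) is empty (p close to 1 and n >= k) its
   probability is 0 and no such bound can hold, so that case is excluded. *)
Theorem theorem1p2 (R : realType) (k : nat) (hk : (1 < k)%N) :
  exists C : R, 0 < C /\
    forall (n : nat) (p : R),
      (0 < n)%N ->
      n%:R `^ (- (2 / (k%:R - 1))) <= p ->
      p <= 1 ->
      (exists G : sgraph 'I_n, 2 * gnp_E p (@xi R k n) <= xi R k G) ->
      expR (- (C * rate k n p)) <=
        gnp_Pr p (fun G : sgraph 'I_n => 2 * gnp_E p (@xi R k n) <= xi R k G).
Proof.
(* [a] is the largest mean allowed by [many_families_bound]. [Cb] and [Ca] are the constants of the
   disjoint-families and planting bounds, and their sum serves both cases. *)
pose a : R := (6 * k%:R ^+ k)^-1.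
pose Cb : R := 3 * - ln (a / (a + 2 ^+ k)).
pose Ca : R := (k + 3)%:R ^+ 2.
have kR : 0 < k%:R ^+ k :> R by rewrite exprn_gt0 // ltr0n ltnW.
have k6 : 0 < 6 * k%:R ^+ k :> R by rewrite mulr_gt0.
have a0 : 0 < a by rewrite invr_gt0.
have ak : a * (6 * k%:R ^+ k) <= 1 by rewrite mulVf ?gt_eqF.
have D0 : 0 < 2 ^+ k :> R by rewrite exprn_gt0.
have Cb0 : 0 <= Cb.
  rewrite mulr_ge0 // oppr_ge0 ln_le0 // ler_pdivrMr ?addr_gt0 //.
  by rewrite mul1r lerDl ltW.
have Ca0 : 0 < Ca by rewrite exprn_gt0 // ltr0n addn3.
exists (Ca + Cb); split; first by rewrite ltr_pwDl.
move=> n p n0 np p1 ex.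
have k1 : 0 < k%:R - 1 :> R by rewrite subr_gt0 ltr1n.
have nR : 0 < n%:R :> R by rewrite ltr0n.
have p0 : 0 < p by apply: lt_le_trans np; rewrite powR_gt0.
pose m2 := n%:R ^+ 2 * p ^+ (k - 1).
(* This is the lower bound on p, raised to the power k - 1. *)
have m2_ge1 : 1 <= m2.
  rewrite -ler_pdivrMl ?exprn_gt0 // mulr1.
  apply: (@le_trans _ _ ((n%:R `^ (- (2 / (k%:R - 1)))) ^+ (k - 1))); last first.
    by rewrite ler_pXn2r ?subn_gt0 ?nnegrE ?powR_ge0 // ltW.
  rewrite -[leRHS]powR_mulrn ?powR_ge0 // -powRrM natrB ?(ltnW hk) //.
  have -> : - (2 / (k%:R - 1)) * (k%:R - 1) = - 2 :> R.
    by field; rewrite gt_eqF.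
  by rewrite powRN powR_mulrn.
have nonempty := upper_tail_nonempty ex.
have L0 := ln_inv_ge0 p0 p1.
have PA := planted_bound p0 p1 hk m2_ge1 nonempty.
have PB := many_families_bound p0 p1 hk a0 ak m2_ge1 nonempty.
rewrite /rate -/m2.
have [AB|BA] := leP (m2 * ln (1 / p)) (n%:R ^+ k * p ^+ 'C(k, 2)).
  apply: le_trans PA; rewrite ler_expR lerN2; apply: ler_wpM2r.
    by rewrite mulr_ge0 // (le_trans ler01).
  by rewrite lerDl.
(* Here mu is strictly the smaller term. By [dense_rate_le] this excludes m2 p^2 > 1 with k >= 3, so
   the disjoint-families bound applies. *)
apply: le_trans (PB _); last first.
  case: (leP (m2 * p ^+ 2) 1) => [|/ltW m2p]; first by left.
  right; apply/eqP; rewrite eqn_leq hk andbT leqNgt; apply/negP => k2.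
  by have := dense_rate_le p0 p1 k2 m2_ge1 m2p; rewrite leNgt BA.
rewrite ler_expR lerN2 -/Cb; apply: ler_wpM2r.
  by rewrite mulr_ge0 ?exprn_ge0 // ltW.
by rewrite lerDr ltW.
Qed.
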